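(* Let $D$ be a digraph. Then $\mathrm{dbw}(D)=\mathrm{hbw}(\mathcal{C}(D)^{*})$, i.e. the directed branchwidth of $D$ equals the hyperbranch-width of the dual of the cycle hypergraph of $D$.
   Context: All digraphs $D=(V(D),E(D))$ are finite, nonempty and simple: no loops and no parallel edges, but both $(u,v)$ and $(v,u)$ may be present (a digon). A directed cycle has pairwise distinct vertices; a digon is a directed cycle of length $2$. For a tree $T$ and an edge $t_1t_2\in E(T)$ let $T_{t_i}$ be the component of $T-t_1t_2$ containing $t_i$. If $\delta$ is a function defined on the leaves of $T$, let $\delta(T_{t_i})$ be the set (family) of images of the leaves of $T$ lying in $T_{t_i}$. A tree consisting of a single vertex is regarded as having one leaf, and then the widths below are $0$. Directed branchwidth. A directed branch decomposition of $D$ is a pair $(T,\delta)$ where $T$ is an undirected tree of maximum degree at most three and $\delta$ is a bijection from the leaves of $T$ to $V(D)$. The thickness of $t_1t_2\in E(T)$ is the minimum size of a set $S\subseteq V(D)$ that meets every directed cycle of $D$ having a vertex in $\delta(T_{t_1})$ and a vertex in $V(D)\setminus\delta(T_{t_1})$. The width of $(T,\delta)$ is the maximum thickness of an edge of $T$, and $\mathrm{dbw}(D)$ is the minimum width of a directed branch decomposition of $D$. Cycle hypergraph and its dual. Hypergraphs may have multiple hyperedges. The cycle hypergraph $\mathcal{C}(D)$ has vertex set $V(D)$ and one hyperedge $V(C)$ for each directed cycle $C$ of $D$. Its dual $\mathcal{C}(D)^{*}$ has one vertex $v_C$ for each directed cycle $C$ of $D$ and, for each $v\in V(D)$, one hyperedge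 $e_v=\{v_C : v\in V(C)\}$ (hyperedges $e_u,e_v$ with $u\ne v$ are regarded as different even if they contain the same vertices; $e_v=\emptyset$ if $v$ lies on no directed cycle). Hyperbranch-width. A hyperbranch decomposition of a hypergraph $H$ is a pair $(T,\delta)$ where $T$ is an undirected tree of maximum degree at most three and $\delta$ is a bijection from the leaves of $T$ to the hyperedges $E(H)$. The thickness of $t_1t_2\in E(T)$ is the minimum size of a set $S\subseteq E(H)$ with $\big(\bigcup\delta(T_{t_1})\big)\cap\big(\bigcup\delta(T_{t_2})\big)\subseteq\bigcup S$. The width of $(T,\delta)$ is the maximum thickness of an edge of $T$, and $\mathrm{hbw}(H)$ is the minimum width of a hyperbranch decomposition of $H$. *)

(* Defs.v *)
From mathcomp Require Import all_boot.
From mathcomp Require Import boolp.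

Set Implicit Arguments.
Unset Strict Implicit.
Unset Printing Implicit Defensive.

(* The least element of a set of natural numbers, and 0 if the set is empty. *)
Definition least (P : nat -> Prop) : nat :=
  if pselect (exists n, `[< P n >]) is left exP then ex_minn exP else 0.

Record digraph := Digraph {
  vertex :> finType;
  arc : rel vertex;
  arc_irr : irreflexive arc;
  vertex_nonempty : 0 < #|vertex|
}.

(* A directed cycle is a subgraph, so it is encoded by its set of arcs; listings
   of the same cycle from different starting points are thereby identified, and
   distinct cycles on the same vertex set are kept apart.  A simple cycle has at
   most #|D| vertices; length 1 is excluded by [arc_irr]. *)
Definition is_dicycle (D : digraph) (A : {set D * D}) : bool :=
  [exists n : 'I_#|D|.+1, exists c : n.-tuple D,
    [&& 0 < n, ucycleb (@arc D) c & A == [set (x, next c x) | x in c]]].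

Definition dicycle (D : digraph) : finType := {A : {set D * D} | is_dicycle A}.

Definition cycle_vertices (D : digraph) (C : dicycle D) : {set D} :=
  [set p.1 | p in val C].

(* Multiple and empty hyperedges are allowed: [hyperedge] is an index type. *)
Record hypergraph := Hypergraph {
  hvertex : finType;
  hyperedge : finType;
  ends : hyperedge -> {set hvertex}
}.

Definition cycle_hypergraph (D : digraph) : hypergraph :=
  @Hypergraph D (dicycle D) (@cycle_vertices D).

Definition dual (H : hypergraph) : hypergraph :=
  @Hypergraph (hyperedge H) (hvertex H)
    (fun v => [set h : hyperedge H | v \in ends h]).

Record tree := Tree {
  node :> finType;
  adj : rel node;
  adj_sym : symmetric adj;
  adj_irr : irreflexive adj;
  node_nonempty : 0 < #|node|;
  adj_connected : forall x y, connect adj x y;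
  (* [:: x; y] with x, y adjacent is a [ucycle] but not a cycle of a graph *)
  adj_acyclic : forall c : seq node, ucycle adj c -> size c <= 2
}.

Definition degree (T : tree) (t : T) : nat := #|[set u | adj t u]|.

(* The tree with a single vertex has one leaf. *)
Definition is_leaf (T : tree) (t : T) : bool :=
  (degree t == 1) || (#|T| == 1).

Definition leaf (T : tree) : finType := {t : T | is_leaf t}.

(* The component of T - t1t2 that contains t1. *)
Definition side (T : tree) (t1 t2 : T) : {set T} :=
  [set t | connect [rel x y | adj x y && ([set x; y] != [set t1; t2])] t1 t].

(* A directed branch decomposition of D is a [branch_decomposition D]; a
   hyperbranch decomposition of H is a [branch_decomposition (hyperedge H)]. *)
Record branch_decomposition (X : finType) := BranchDecomposition {
  dtree : tree;
  delta : leaf dtree -> X;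
  dtree_degree : forall t : dtree, degree t <= 3;
  delta_bij : bijective delta
}.

Definition leaf_image (X : finType) (B : branch_decomposition X)
    (t1 t2 : dtree B) : {set X} :=
  [set delta l | l : leaf (dtree B) & val l \in side t1 t2].

Section DirectedBranchwidth.

Variable D : digraph.

Definition hits_crossing_cycles (X S : {set D}) : bool :=
  [forall C : dicycle D,
    (cycle_vertices C :&: X != set0) && (cycle_vertices C :&: ~: X != set0)
      ==> (cycle_vertices C :&: S != set0)].

(* [setT] satisfies the constraint, so the minimum is a genuine one. *)
Definition dthickness (B : branch_decomposition D) (t1 t2 : dtree B) : nat :=
  #|[arg min_(S < [set: D] | hits_crossing_cycles (leaf_image t1 t2) S) #|S|]|.

Definition dwidth (B : branch_decomposition D) : nat :=
  \max_(t : dtree B * dtree B | adj t.1 t.2) dthickness t.1 t.2.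

Definition dbw : nat :=
  least (fun k => exists B : branch_decomposition D, dwidth B = k).

End DirectedBranchwidth.

Section HyperbranchWidth.

Variable H : hypergraph.

Definition bigunion (S : {set hyperedge H}) : {set hvertex H} :=
  \bigcup_(h in S) ends h.

(* [setT] satisfies the constraint here too. *)
Definition hthickness (B : branch_decomposition (hyperedge H))
    (t1 t2 : dtree B) : nat :=
  #|[arg min_(S < [set: hyperedge H] |
       bigunion (leaf_image t1 t2) :&: bigunion (leaf_image t2 t1)
         \subset bigunion S) #|S|]|.

Definition hwidth (B : branch_decomposition (hyperedge H)) : nat :=
  \max_(t : dtree B * dtree B | adj t.1 t.2) hthickness t.1 t.2.

Definition hbw : nat :=
  least (fun k => exists B : branch_decomposition (hyperedge H), hwidth B = k).

End HyperbranchWidth.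

(* Main.v *)
(** A branch decomposition of [D] and one of the dual hypergraph are the same
    object, since the hyperedges of the dual are indexed by the vertices of [D].
    Removing an edge of the tree splits the vertices into [X] and its complement;
    a cycle [C] meets both parts iff the dual vertex [v_C] lies in both unions of
    hyperedges, and [S] hits [C] iff [v_C] is covered by [S].  Hence both
    thicknesses minimise over the same sets. *)

Require Import Defs.
From mathcomp Require Import all_boot.
From mathcomp Require Import boolp.

Set Implicit Arguments.
Unset Strict Implicit.
Unset Printing Implicit Defensive.

Section TreeEdge.

Variables (T : tree) (t1 t2 : T).
Hypothesis t12 : adj t1 t2.

Let off_edge : rel T := [rel x y | adj x y && ([set x; y] != [set t1; t2])].

Lemma off_edge_sym : connect_sym off_edge.
Proof.
by apply: sym_connect_sym => x y; rewrite /off_edge /= adj_sym setUC.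
Qed.

Lemma side_swapE (x : T) : (x \in side t2 t1) = connect off_edge t2 x.
Proof.
by rewrite inE; apply: eq_connect => y z /=; rewrite [[set t2; t1]]setUC.
Qed.

(* A path off the edge, closed up by the edge, would be a cycle of length > 2. *)
Lemma tree_edge_bridge : ~~ connect off_edge t1 t2.
Proof.
apply/negP => /connectP[p p_off lastp].
case/shortenP: p_off lastp => q q_off q_uniq _ lastq.
have q_adj : path (@adj T) t1 q.
  by apply: (sub_path _ q_off) => x y; rewrite /off_edge /= => /andP[].
have /adj_acyclic : ucycle (@adj T) (t1 :: q).
  by apply/andP; split; rewrite // /cycle rcons_path q_adj -lastq adj_sym.
rewrite /off_edge in q_off.
case: q q_off lastq {q_uniq q_adj} => [|y [|z q]] //= => [_ eq12|].
  by move: t12; rewrite eq12 adj_irr.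
by rewrite andbT => /andP[_ /eqP ne] eq2 _; case: ne; rewrite eq2.
Qed.

(** The union of the two sides is closed under adjacency and contains [t1], so it is everything, the
    tree being connected. *)
Lemma side_cover (x : T) : (x \in side t1 t2) || (x \in side t2 t1).
Proof.
pose A := [pred y | (y \in side t1 t2) || (y \in side t2 t1)].
suff clA : closed (@adj T) A.
  rewrite -[_ || _]/(x \in A) -(closed_connect clA (adj_connected t1 x)).
  by rewrite !inE connect0.
apply: intro_closed; first exact/sym_connect_sym/adj_sym.
move=> y z yz; rewrite -!topredE /= !side_swapE !inE -/off_edge => yA.
(* Crossing the removed edge lands on [t1] or [t2], each of which lies in its own side. *)
have [E|ne] := eqVneq [set y; z] [set t1; t2].
  have : z \in [set t1; t2] by rewrite -E !inE eqxx orbT.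
  by rewrite !inE => /orP[] /eqP ->; rewrite connect0 ?orbT.
have yz_off : connect off_edge y z by apply: connect1; rewrite /off_edge /= yz.
move: yA.
by case/orP => /connect_trans /(_ yz_off) ->; rewrite ?orbT.
Qed.

Lemma side_swap : side t2 t1 = ~: side t1 t2.
Proof.
apply/setP => x; rewrite in_setC; have := side_cover x.
rewrite side_swapE inE -/off_edge.
case: (boolP (connect off_edge t1 x)) => //= t1x _; apply/negP => t2x.
by have /negP[] := tree_edge_bridge; apply: connect_trans t1x _; rewrite off_edge_sym.
Qed.

End TreeEdge.

(** Reconciles the two thicknesses: the directed one uses a complement, the other the opposite side
    of the edge. Bijectivity of [delta] carries [side_swap] over to [X]. *)
Lemma leaf_image_swap (X : finType) (B : branch_decomposition X)
    (t1 t2 : dtree B) :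
  adj t1 t2 -> leaf_image t2 t1 = ~: leaf_image t1 t2.
Proof.
move=> t12; have [g deltaK gK] := delta_bij B.
have mem_image (u v : dtree B) x :
    (x \in leaf_image u v) = (val (g x) \in side u v).
  apply/imsetP/idP => [[l]|gx]; first by rewrite in_set => lu ->; rewrite deltaK.
  by exists (g x); rewrite ?gK // in_set.
by apply/setP => x; rewrite in_setC !mem_image side_swap // in_setC.
Qed.

Section Duality.

Variable D : digraph.
Let H := dual (cycle_hypergraph D).

Lemma mem_bigunion_dual (X : {set D}) (C : dicycle D) :
  (C \in bigunion (X : {set hyperedge H})) = (cycle_vertices C :&: X != set0).
Proof.
apply/bigcupP/set0Pn => [[v vX]|[v]].
  by rewrite inE => vC; exists v; rewrite inE vC.
by rewrite inE => /andP[vC vX]; exists v => //; rewrite inE.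
Qed.

Lemma hits_crossing_cyclesE (X S : {set D}) :
  hits_crossing_cycles X S =
  (bigunion (X : {set hyperedge H}) :&: bigunion (~: X : {set hyperedge H})
     \subset bigunion (S : {set hyperedge H})).
Proof.
apply/forallP/subsetP => [hit C|sub C].
  by rewrite in_setI !mem_bigunion_dual; apply/implyP.
by apply/implyP; move: (sub C); rewrite in_setI !mem_bigunion_dual.
Qed.

Lemma dthickness_dual (B : branch_decomposition D) (t1 t2 : dtree B) :
  adj t1 t2 ->
  dthickness t1 t2 = @hthickness H (B : branch_decomposition (hyperedge H)) t1 t2.
Proof.
move=> t12; rewrite /dthickness /hthickness (leaf_image_swap t12).
(* The two constraints on [S] agree as predicates, so even the chosen minimisers coincide. *)
by congr #|pred_of_set (arg_min _ _ _)|; apply/funext => S;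
  rewrite hits_crossing_cyclesE.
Qed.

Lemma dwidth_dual (B : branch_decomposition D) :
  dwidth B = @hwidth H (B : branch_decomposition (hyperedge H)).
Proof. by apply: eq_bigr => t /dthickness_dual. Qed.

End Duality.

Theorem theorem3p7 (D : digraph) : dbw D = hbw (dual (cycle_hypergraph D)).
Proof.
rewrite /dbw /hbw; congr least; apply/funext => k; apply/propext.
(* The same [B] serves both ways, as [hyperedge] of the dual is convertible to [D]. *)
by split=> -[B Bk]; exists B; rewrite -Bk dwidth_dual.
Qed.
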